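(* Let $\{G_\alpha:\alpha\in A\}$ be a family of $g$-sequential topological groups. If the cardinal $\mathrm{Card}(A)$ is not $g$-sequential, then the product $G=\prod_{\alpha\in A}G_\alpha$ is a $g$-sequential topological group.
   Context: Topological groups are assumed Hausdorff. A topological group $G$ is $g$-sequential if for every topological group $H$, every sequentially continuous homomorphism $f:G\to H$ is continuous (equivalently, $G$ admits no strictly finer group topology with the same convergent sequences). For a set $E$ let $P(E)$ be the set of all subsets of $E$. A subadditive measure on $E$ is a function $p:P(E)\to[0,1]$ which is monotone ($A\subset B$ implies $p(A)\le p(B)$) and such that: (1) $p(A\cup B)\le p(A)+p(B)$ for all $A,B\in P(E)$ with $A\cap B=\emptyset$; (2) for every decreasing sequence $A_1\supset A_2\supset\dots$ in $P(E)$ with $\bigcap_n A_n=\emptyset$ we have $\lim_n p(A_n)=0$. A cardinal $\tau=\mathrm{Card}(E)$ is $g$-sequential if there is a subadditive measure $p$ on $E$ such that $p(E)=1$ and $p(F)=0$ for all finite subsets $F\subset E$. *)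

(* Defs.v *)
From HB Require Import structures.
From mathcomp Require Import all_boot all_order all_algebra.
From mathcomp Require Import all_classical all_reals all_analysis.
Import Order.TTheory GRing.Theory Num.Theory.
Import numFieldNormedType.Exports.

Set Implicit Arguments.
Unset Strict Implicit.
Unset Printing Implicit Defensive.

Local Open Scope classical_set_scope.
Local Open Scope ring_scope.

HB.structure Definition PreTopologicalGroup :=
  {G of Topological G & Group G}.

HB.mixin Record PreTopologicalGroup_isTopologicalGroup G
    of PreTopologicalGroup G := {
  mulg_continuous : continuous (fun x : G * G => (x.1 * x.2)%g);
  invg_continuous : continuous (fun x : G => (x^-1)%g);
  tgroup_hausdorff : hausdorff_space G
}.

#[short(type="topologicalGroupType")]
HB.structure Definition TopologicalGroup :=
  {G of PreTopologicalGroup G & PreTopologicalGroup_isTopologicalGroup G}.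

(* Convergence in the library's product topology is coordinatewise; the index
   type is arbitrary, whereas function_spaces requires an eqType. *)
Section ProductCvg.
Context (I : Type) (T : I -> topologicalType).

Lemma prod_topology_cvgP (F : set_system (prod_topology T))
    (t : prod_topology T) : Filter F ->
  F --> t <-> forall i, (fun f : prod_topology T => f i) @ F --> t i.
Proof.
move=> FF; split=> [Ft i|Ft].
  have /cvg_sup/(_ i) Fti := Ft.
  move=> U; rewrite nbhsE => -[W [oW Wt] WU].
  apply: (@filterS _ F _ ((fun f : prod_topology T => f i) @^-1` W)) => [f /WU//|].
  by apply: Fti; exists ((fun f : prod_topology T => f i) @^-1` W); split=> //; exists W.
apply/cvg_sup => i U [V /= [[W oW <-] Wt]] /filterS; apply.
by apply: (Ft i); exact: open_nbhs_nbhs.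
Qed.

Lemma prod_topology_proj_continuous i :
  continuous (fun f : prod_topology T => f i).
Proof. by move=> f; have /prod_topology_cvgP/(_ i) : f --> f by exact: cvg_id. Qed.

Lemma prod_topology_hausdorff :
  (forall i, hausdorff_space (T i)) -> hausdorff_space (prod_topology T).
Proof.
move=> hT p q pq; apply: functional_extensionality_dep => i; apply: hT.
move=> A B Ap Bq.
have [f [/= Af Bf]] := pq _ _ (prod_topology_proj_continuous Ap)
                        (prod_topology_proj_continuous Bq).
by exists (f i).
Qed.

End ProductCvg.

Section ProductGroup.
Context (I : Type) (G : I -> topologicalGroupType).
Local Notation PG := (prod_topology G).

Let mulp (x y : PG) : PG := fun i => (x i * y i)%g.
Let onep : PG := fun i => 1%g.
Let invp (x : PG) : PG := fun i => (x i)^-1%g.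

Let mulpA : associative mulp.
Proof. by move=> x y z; apply: functional_extensionality_dep => i; exact: mulgA. Qed.

Let mul1p : left_id onep mulp.
Proof. by move=> x; apply: functional_extensionality_dep => i; exact: mul1g. Qed.

Let mulp1 : right_id onep mulp.
Proof. by move=> x; apply: functional_extensionality_dep => i; exact: mulg1. Qed.

Let mulVp : left_inverse onep invp mulp.
Proof. by move=> x; apply: functional_extensionality_dep => i; exact: mulVg. Qed.

Let mulpV : right_inverse onep invp mulp.
Proof. by move=> x; apply: functional_extensionality_dep => i; exact: mulgV. Qed.

HB.instance Definition _ := isGroup.Build PG mulpA mul1p mulp1 mulVp mulpV.

Let mulp_continuous : continuous (fun x : PG * PG => (x.1 * x.2)%g).
Proof.
move=> x; apply/prod_topology_cvgP => i.
apply: (@continuous_comp _ _ _ (fun x : PG * PG => (x.1 i, x.2 i))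
  (fun y : G i * G i => (y.1 * y.2)%g)); last exact: mulg_continuous.
apply: cvg_pair.
- apply: (@continuous_comp _ _ _ fst (fun f : PG => f i)); first exact: cvg_fst.
  exact: prod_topology_proj_continuous.
- apply: (@continuous_comp _ _ _ snd (fun f : PG => f i)); first exact: cvg_snd.
  exact: prod_topology_proj_continuous.
Qed.

Let invp_continuous : continuous (fun x : PG => (x^-1)%g).
Proof.
move=> x; apply/prod_topology_cvgP => [|i].
  exact/fmap_filter/nbhs_filter.
apply: (@continuous_comp _ _ _ (fun f : PG => f i)
  (fun y : G i => (y^-1)%g)); last exact: invg_continuous.
exact: prod_topology_proj_continuous.
Qed.

Let prodg_hausdorff : hausdorff_space PG.
Proof. by apply: prod_topology_hausdorff => i; exact: tgroup_hausdorff. Qed.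

HB.instance Definition _ := PreTopologicalGroup_isTopologicalGroup.Build PG
  mulp_continuous invp_continuous prodg_hausdorff.

End ProductGroup.

Definition sequentially_continuous (X Y : topologicalType) (f : X -> Y) :=
  forall (u : nat -> X) (x : X),
    u n @[n --> \oo] --> x -> f (u n) @[n --> \oo] --> f x.

Definition g_sequential (G : topologicalGroupType) :=
  forall (H : topologicalGroupType) (f : {multiplicative G -> H}),
    sequentially_continuous f -> continuous f.

Record subadditive_measure (R : realType) (E : Type) (p : set E -> R) : Prop :=
  SubadditiveMeasure {
  submeas_ge0_le1 : forall A, 0 <= p A <= 1;
  submeas_monotone : forall A B, A `<=` B -> p A <= p B;
  submeas_subadditive : forall A B, A `&` B = set0 -> p (A `|` B) <= p A + p B;
  submeas_cvg0 : forall A : nat -> set E,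
    (forall n, A n.+1 `<=` A n) -> \bigcap_n A n = set0 ->
    p (A n) @[n --> \oo] --> (0 : R)
}.

(* A cardinal is represented by a type of that cardinality; the lemma after the
   definition shows that the choice of the type is irrelevant. *)
Definition card_g_sequential (R : realType) (E : Type) :=
  exists p : set E -> R,
    [/\ subadditive_measure p, p [set: E] = 1
      & forall F, finite_set F -> p F = 0].

Lemma card_g_sequential_bij (R : realType) (E F : Type) (f : E -> F) :
  bijective f -> card_g_sequential R E -> card_g_sequential R F.
Proof.
move=> bf [p [[p01 pm ps pc] p1 p0]]; exists (fun B => p (f @^-1` B)); split.
- split=> [B|B C BC|B C BC|B Bd B0]; first exact: p01.
  + by apply: pm => x /BC.
  + by rewrite preimage_setU; apply: ps; rewrite -preimage_setI BC preimage_set0.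
  + apply: pc => [n x /Bd//|].
    by rewrite -preimage_bigcap B0 preimage_set0.
- by rewrite preimage_setT.
- move=> B finB; apply: p0; apply: finite_preimage => // x y _ _.
  exact: bij_inj bf _ _.
Qed.

(* Main.v *)
From HB Require Import structures.
Require Import Defs.
From mathcomp Require Import all_boot all_order all_algebra.
From mathcomp Require Import all_classical all_reals all_analysis.
From mathcomp Require Import lra.
Import Order.TTheory GRing.Theory Num.Theory.
Import numFieldNormedType.Exports.

Set Implicit Arguments.
Unset Strict Implicit.
Unset Printing Implicit Defensive.

Local Open Scope classical_set_scope.
Local Open Scope ring_scope.

(** Let f be a sequentially continuous homomorphism from the product to H, and U
a neighborhood of 1 in H; continuity of f at 1 is enough. Choose a subadditive
N : H -> [0, 1] tending to 0 at 1, with {N < 1/2} contained in U (exists_prenorm,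
after Birkhoff and Kakutani), put g = N o f, and let p(B) be the supremum of g
over the points of the product whose coordinates outside B are trivial.

Sequential continuity makes p a subadditive measure on the index set: if the
sets B_n decrease to the empty set, then any points x_n supported in B_n converge
to 1, since each coordinate is eventually trivial; hence g(x_n) tends to 0, and so
does p(B_n) because the x_n may be chosen nearly optimal
(support_measure_subadditive).

Although p need not vanish on finite sets, q(B) = inf p(B minus F), F finite, is a
subadditive measure which does. Were q(A) positive, q / q(A) would make Card(A)
g-sequential; so q(A) = 0, that is, some finite F satisfies p(A minus F) < 1/4
(submeas_finite_approx).

Finally split x as its restriction to F times its restriction to the complement.
The second factor contributes at most p(A minus F) < 1/4 to g(x), whatever x is.
The first is a product of finitely many coordinates, on each of which f is
continuous because G_a is g-sequential, so it contributes less than 1/4 for x near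
1 (cvg_restrict_finite). Hence f(x) lies in U for all x near 1. *)

(** * Prenorms on topological groups *)

Section Prenorm.
Context (R : realType).

(** The element x is the one at which the partial sums first reach a, or the last
one if they never do. With a = b this cuts a sum below 2a into two sums
below a around a single term, the inductive step of chain_prod_in. *)
Lemma split_sum_lt (T : Type) (w : T -> R) (s : seq T) (a b : R) :
  (forall x, 0 <= w x) -> s <> [::] -> 0 < a -> 0 < b ->
  \sum_(x <- s) w x < a + b ->
  exists pre x post, [/\ s = pre ++ x :: post,
    \sum_(y <- pre) w y < a & \sum_(y <- post) w y < b].
Proof.
move=> w0; elim: s a => [//|y s IH] a _ a0 b0; rewrite big_cons => sab.
have [ya|ay] := ltP (w y) a; last first.
  exists [::], y, s; split=> //; rewrite ?big_nil//; lra.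
case: s => [|z s] in IH sab *.
  by exists [::], y, [::]; split=> //; rewrite big_nil.
have a'0 : 0 < a - w y by lra.
have sab' : \sum_(x <- z :: s) w x < a - w y + b by lra.
have [//|pre [x [post [-> pa pb]]]] := IH (a - w y) _ a'0 b0 sab'.
exists (y :: pre), x, post; split=> //; rewrite big_cons; lra.
Qed.

Lemma nbhs1_mul3 (H : topologicalGroupType) (U : set H) : nbhs 1%g U ->
  exists V : set H, nbhs 1%g V /\
    forall x y z, V x -> V y -> V z -> U (x * y * z)%g.
Proof.
have mul2 (W : set H) : nbhs 1%g W -> exists V : set H, nbhs 1%g V /\
    forall x y, V x -> V y -> W (x * y)%g.
  move=> W1; have := @mulg_continuous H (1%g, 1%g) W.
  rewrite /= mulg1 => /(_ W1)[[V1 V2] /= [V11 V21] V12W].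
  exists (V1 `&` V2); split; first exact: filterI.
  by move=> x y [V1x _] [_ V2y]; exact: (V12W (x, y)).
move=> /mul2[W [W1 WU]]; have [V [V1 VW]] := mul2 _ W1.
exists (V `&` W); split; first exact: filterI.
by move=> x y z [Vx _] [Vy _] [_ Wz]; apply: WU => //; exact: VW.
Qed.

Section Chains.
Context (H : groupType) (V : nat -> set H).
Hypothesis V1 : forall n, V n 1%g.
Hypothesis V3 : forall n x y z,
  V n.+1 x -> V n.+1 y -> V n.+1 z -> V n (x * y * z)%g.

Local Notation half := (2^-1 : R).

(** A chain is a list of pairs (x, k) with x in V k; such a pair costs 2^-k and the
chain stands for a factorization of the product of its elements. *)
Definition chain_cost (s : seq (H * nat)) : R := \sum_(p <- s) half ^+ p.2.
Definition chain_prod (s : seq (H * nat)) : H := (\prod_(p <- s) p.1)%g.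
Definition is_chain (s : seq (H * nat)) := all (fun p => p.1 \in V p.2) s.

Lemma filtration_le m n : (m <= n)%N -> V n `<=` V m.
Proof.
move=> /subnK <-; elim: (n - m)%N => [//|k IH] x; rewrite addSn => Vx.
by apply: IH; rewrite -[x]mulg1 -[x]mulg1; exact: V3.
Qed.

(** The chain lemma of Birkhoff and Kakutani: a chain of cost less than 2^-n is cut
by split_sum_lt into two chains of cost less than 2^-(n+1) and one term, whose
own index must exceed n. By induction all three factors lie in V n.+1,
and V3 multiplies them into V n. *)
Lemma chain_prod_in s n :
  is_chain s -> chain_cost s < half ^+ n -> V n (chain_prod s).
Proof.
have [m] := ubnP (size s); elim: m s n => // m IH s n + Vs sn.
have [->|s0] := eqVneq s [::]; first by rewrite /chain_prod big_nil.
have h0 k : 0 < half ^+ k by rewrite exprn_gt0// invr_gt0.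
have hS k : half ^+ k = half ^+ k.+1 + half ^+ k.+1 by rewrite exprS; lra.
have [p|||||pre [[x k] [post [sE pa pb]]]] :=
    @split_sum_lt _ (fun p : H * nat => half ^+ p.2) s (half ^+ n.+1) (half ^+ n.+1).
- exact/ltW/h0.
- exact/eqP.
- exact: h0.
- exact: h0.
- by rewrite -hS.
move: Vs sn; rewrite {}sE /is_chain all_cat /= => /and3P[Vpre Vx Vpost] sn sm.
rewrite /chain_prod big_cat big_cons /= mulgA; move: sm.
rewrite size_cat /= addnS ltnS => sm; apply: V3.
- by apply: IH => //; rewrite (leq_ltn_trans _ sm)// leq_addr.
- apply: (@filtration_le _ k); last by rewrite inE in Vx.
  rewrite ltnNge; apply/negP => kn; move: sn; apply/negP; rewrite -leNgt.
  rewrite /chain_cost big_cat big_cons /=.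
  have : half ^+ n <= half ^+ k by apply: ler_wiXn2l => //; lra.
  have s0' t : 0 <= \sum_(p <- t) half ^+ (p : H * nat).2.
    by apply: sumr_ge0 => p _; exact/ltW/h0.
  by have := s0' pre; have := s0' post; lra.
- by apply: IH => //; rewrite (leq_ltn_trans _ sm)// leq_addl.
Qed.

End Chains.

(** N x is the infimum of the costs of the factorizations of x along a
filtration V with V 0 the whole group and V 1 = U: subadditivity is concatenation of factorizations,
continuity at 1 comes from the one-term factorizations, and chain_prod_in says
that a cost below 1/2 forces x into V 1. *)
Lemma exists_prenorm (H : topologicalGroupType) (U : set H) : nbhs 1%g U ->
  exists N : H -> R, [/\ forall x, 0 <= N x <= 1,
    forall x y, N (x * y)%g <= N x + N y,
    N x @[x --> 1%g] --> (0 : R) & forall x, N x < 2^-1 -> U x].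
Proof.
move=> U1.
have /choice[next nextP] (W : set H) : exists V : set H, nbhs 1%g W ->
    nbhs 1%g V /\ forall x y z, V x -> V y -> V z -> W (x * y * z)%g.
  have [/nbhs1_mul3[V VP]|nW] := pselect (nbhs 1%g W); first by exists V.
  by exists W.
pose V n := if n is k.+1 then iter k next U else setT.
have V1 n : nbhs 1%g (V n).
  case: n => [|n]; first exact: filterT.
  by elim: n => [//|n /= /nextP[]].
have V11 n : V n 1%g := nbhs_singleton (V1 n).
have V3 n x y z : V n.+1 x -> V n.+1 y -> V n.+1 z -> V n (x * y * z)%g.
  by case: n => [//|n] /=; have [_] := nextP _ (V1 n.+1); exact.
pose costs x := [set chain_cost s | s in
  [set s : seq (H * nat) | is_chain V s /\ chain_prod s = x]].
have cost_ge0 s : 0 <= @chain_cost H s.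
  by apply: sumr_ge0 => p _; rewrite exprn_ge0// invr_ge0.
have costs_lb x : lbound (costs x) 0 by move=> _ [s _ <-].
have costs_hlb x : has_lbound (costs x) by exists 0.
have costs1 x k : V k x -> costs x (2^-1 ^+ k).
  move=> Vx; exists [:: (x, k)]; last by rewrite /chain_cost big_seq1.
  by split; rewrite /is_chain /chain_prod ?big_seq1//= andbT inE.
have costs0 x : costs x !=set0 by exists (2^-1 ^+ 0); exact: costs1.
have NV x k : V k x -> inf (costs x) <= 2^-1 ^+ k.
  by move=> Vx; apply: ge_inf => //; exact: costs1.
have N0 x : 0 <= inf (costs x) by apply: lb_le_inf.
exists (fun x => inf (costs x)); split.
- by move=> x; rewrite N0 -(expr0 2^-1) NV.
- move=> x y; apply/ler_addgt0Pr => e e0.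
  have e2 : 0 < e / 2 by lra.
  have [_ [s [Vs <-] <-] sx] := inf_adherent e2 (conj (costs0 x) (costs_hlb x)).
  have [_ [t [Vt <-] <-] ty] := inf_adherent e2 (conj (costs0 y) (costs_hlb y)).
  apply: (@le_trans _ _ (chain_cost (s ++ t))); last first.
    rewrite /chain_cost big_cat /=; rewrite /chain_cost in sx ty; lra.
  apply: ge_inf => //; exists (s ++ t) => //.
  by rewrite /is_chain /chain_prod /= all_cat big_cat; split=> //; apply/andP.
- apply/cvgr0Pnorm_lt => e e0.
  have /cvgr0Pnorm_lt/(_ _ e0)[k _ /(_ k (leqnn k))] :
      (2^-1 : R) ^+ n @[n --> \oo] --> (0 : R).
    by apply: cvg_expr; rewrite ger0_norm; lra.
  rewrite /= ger0_norm ?exprn_ge0 ?invr_ge0// => ke.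
  apply: filterS (V1 k) => x /NV xk; rewrite ger0_norm//; exact: le_lt_trans ke.
- move=> x /(inf_lt (costs0 x))[_ [s [Vs <-] <-] s2].
  by apply: (@chain_prod_in _ V V11 V3 s 1).
Qed.

End Prenorm.

(** * Subadditive measures modulo finite sets *)

Section FiniteApproximation.
Context (R : realType) (E : Type).

(** If p(~ F) stayed above e for all finite F, then the infimum q(B) of p(B \ F)
over finite F would be a subadditive measure vanishing on finite sets with
q(E) >= e, and q / q(E) would witness that Card(E) is g-sequential. *)
Lemma submeas_finite_approx (p : set E -> R) :
  subadditive_measure p -> ~ card_g_sequential R E ->
  forall e, 0 < e -> exists2 F, finite_set F & p (~` F) < e.
Proof.
move=> [p01 pm ps pc] nE e e0; apply: contrapT => nF.
have p0 A : 0 <= p A by case/andP: (p01 A).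
have pF F : finite_set F -> e <= p (~` F).
  by move=> finF; rewrite leNgt; apply/negP => pFe; apply: nF; exists F.
pose vals B := [set p (B `\` F) | F in finite_set (T:=E)].
have vals_hlb B : has_lbound (vals B) by exists 0 => _ [F _ <-].
have vals0 B : vals B !=set0 by exists (p (B `\` set0)), set0.
pose q B := inf (vals B).
have qle B F : finite_set F -> q B <= p (B `\` F).
  by move=> finF; apply: ge_inf => //; exists F.
have q0 B : 0 <= q B by apply: lb_le_inf => // _ [F _ <-].
have qm A B : A `<=` B -> q A <= q B.
  move=> AB; apply: lb_le_inf => // _ [F finF <-].
  by apply: le_trans (qle A F finF) _; apply: pm => x [/AB].
have qT : 0 < q setT.
  apply: (lt_le_trans e0); apply: lb_le_inf => // _ [F finF <-].
  by rewrite setTD; exact: pF.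
apply: nE; exists (fun B => q B / q setT); split.
- split=> [A|A B AB|A B AB|A Ad A0].
  + by rewrite divr_ge0//= ler_pdivrMr// mul1r qm.
  + by rewrite ler_pM2r ?invr_gt0// qm.
  + rewrite -mulrDl ler_pM2r ?invr_gt0//; apply/ler_addgt0Pr => d d0.
    have d2 : 0 < d / 2 by lra.
    have [_ [F finF <-] FA] := inf_adherent d2 (conj (vals0 A) (vals_hlb A)).
    have [_ [K finK <-] KB] := inf_adherent d2 (conj (vals0 B) (vals_hlb B)).
    have finFK : finite_set (F `|` K) by rewrite finite_setU.
    have := qle (A `|` B) _ finFK.
    have : p ((A `|` B) `\` (F `|` K)) <= p ((A `\` F) `|` (B `\` K)).
      by apply: pm => x [[Ax|Bx] /not_orP[nF' nK]]; [left|right].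
    have : p ((A `\` F) `|` (B `\` K)) <= p (A `\` F) + p (B `\` K).
      apply: ps; apply/seteqP; split=> // x [[Ax _] [Bx _]].
      by rewrite -AB.
    rewrite /q; lra.
  + rewrite -(mul0r (q setT)^-1); apply: cvgMl.
    apply: (@squeeze_cvgr _ _ _ _ (fun=> 0) (fun n => p (A n))).
    * near=> n; rewrite q0 /= (le_trans (qle _ _ (finite_set0 E)))//.
      by rewrite setD0.
    * exact: cvg_cst.
    * exact: pc.
- by rewrite divff// gt_eqF.
- move=> F finF; apply/eqP; rewrite mulf_eq0; apply/orP; left.
  rewrite eq_le q0 andbT; have := qle F F finF; rewrite setDv.
  suff -> : p set0 = 0 by [].
  have /(cvg_lim (@Rhausdorff R)) : p ((fun=> set0) n) @[n --> \oo] --> (0 : R).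
    by apply: (pc (fun=> set0)) => [_ //|]; rewrite bigcap_const//; exists 0%N.
  by rewrite lim_cst.
Unshelve. all: by end_near. Qed.

End FiniteApproximation.

(** * Supports in a product of topological groups *)

Section ProductSupport.
Context (I : Type) (G : I -> topologicalGroupType).
Local Notation PG := (prod_topology G).

Definition restrict_coords (B : set I) (x : PG) : PG :=
  fun i => if `[< B i >] then x i else 1%g.

Lemma restrict_coordsU A B x : A `&` B = set0 ->
  restrict_coords (A `|` B) x =
  (restrict_coords A x * restrict_coords B x)%g.
Proof.
move=> AB; apply: functional_extensionality_dep => i.
rewrite /restrict_coords asbool_or.
have -> (y z : PG) : (y * z)%g i = (y i * z i)%g by [].
case: asboolP => Ai; case: asboolP => Bi //=; rewrite ?mulg1 ?mul1g//.
by suff : (A `&` B) i by rewrite AB.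
Qed.

Lemma restrict_coords_sub A B x : A `<=` B ->
  restrict_coords B (restrict_coords A x) = restrict_coords A x.
Proof.
move=> AB; apply: functional_extensionality_dep => i; rewrite /restrict_coords.
by case: (asboolP (B i)) => // nBi; case: asboolP => // /AB.
Qed.

Lemma restrict_coordsT x : restrict_coords setT x = x.
Proof.
by apply: functional_extensionality_dep => i; rewrite /restrict_coords asboolT.
Qed.

Lemma restrict_coords0 x : restrict_coords set0 x = 1%g.
Proof.
by apply: functional_extensionality_dep => i; rewrite /restrict_coords asboolF.
Qed.

(** Each index leaves B n at some rank, after which the corresponding coordinate
is constantly 1, however the points u n are chosen. *)
Lemma cvg_restrict_coords (B : nat -> set I) (u : nat -> PG) :
  (forall n, B n.+1 `<=` B n) -> \bigcap_n B n = set0 ->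
  restrict_coords (B n) (u n) @[n --> \oo] --> (1%g : PG).
Proof.
move=> Bd B0; apply/prod_topology_cvgP => i.
have [m nBmi] : exists m, ~ B m i.
  apply: contrapT => /forallNP Bi.
  suff : (\bigcap_n B n) i by rewrite B0.
  by move=> n _; exact: contrapT (Bi n).
apply: cvg_near_cst; exists m => // n /= mn.
rewrite /restrict_coords asboolF// => Bni; apply: nBmi.
move: Bni; rewrite -(subnK mn); elim: (n - m)%N => [//|k IH].
by rewrite addSn => /Bd.
Qed.

(** The index type carries no decidable equality, hence the classical test on i = j
and the transport of y along it. *)
Definition inj_coord (i : I) (y : G i) : PG := fun j =>
  match pselect (i = j) with
  | left ij => ecast j (G j) ij y
  | right _ => 1%g
  end.

Lemma inj_coord_mul i : {morph @inj_coord i : x y / (x * y)%g}.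
Proof.
move=> x y; apply: functional_extensionality_dep => j.
have -> (u v : PG) : (u * v)%g j = (u j * v j)%g by [].
by rewrite /inj_coord; case: pselect => [ij|_]; [case: _ / ij|rewrite mulg1].
Qed.

HB.instance Definition _ i :=
  isMultiplicative.Build (G i) PG (@inj_coord i) (@inj_coord_mul i).

Lemma inj_coord_continuous i : continuous (@inj_coord i).
Proof.
move=> x; apply/prod_topology_cvgP => j.
suff : inj_coord y j @[y --> x] --> inj_coord x j by [].
rewrite /inj_coord; case: pselect => [ij|_]; last exact: cvg_cst.
by case: _ / ij; exact: cvg_id.
Qed.

Lemma restrict_coords1 i x : restrict_coords [set i] x = inj_coord (x i).
Proof.
apply: functional_extensionality_dep => j; rewrite /restrict_coords /inj_coord.
case: asboolP => [/= ->|ji]; case: pselect => [ij|//].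
- by rewrite (Prop_irrelevance ij erefl).
- by case: ji.
Qed.

Section SupportMeasure.
Context (R : realType) (g : PG -> R).
Hypothesis g01 : forall x, 0 <= g x <= 1.
Hypothesis gM : forall x y, g (x * y)%g <= g x + g y.
Hypothesis g_seq : forall u : nat -> PG,
  u n @[n --> \oo] --> (1%g : PG) -> g (u n) @[n --> \oo] --> (0 : R).

(** The points restrict_coords B x are exactly those supported in B, so this is the
supremum of g over the subgroup of points supported in B. *)
Definition support_measure (B : set I) : R :=
  sup (range (fun x => g (restrict_coords B x))).

Let hub B : has_ubound (range (fun x => g (restrict_coords B x))).
Proof. by exists 1 => _ [x _ <-]; case/andP: (g01 (restrict_coords B x)). Qed.

Let ne B : range (fun x => g (restrict_coords B x)) !=set0.
Proof. by exists (g (restrict_coords B 1%g)), 1%g. Qed.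

Lemma support_measure_ge B x : g (restrict_coords B x) <= support_measure B.
Proof. by apply: ub_le_sup => //; exists x. Qed.

Let support_measure_ge0 B : 0 <= support_measure B.
Proof.
by apply: le_trans (support_measure_ge B 1%g); case/andP: (g01 (restrict_coords B 1%g)).
Qed.

(** Points supported in a disjoint union factor, which gives subadditivity. For
continuity along a sequence A n decreasing to the empty set, points nearly
realizing the suprema converge to 1 by cvg_restrict_coords, so that g_seq
applies to them. *)
Lemma support_measure_subadditive : subadditive_measure support_measure.
Proof.
split=> [A|A B AB|A B AB|A Ad A0].
- rewrite support_measure_ge0 /=; apply: ge_sup => // _ [x _ <-].
  by case/andP: (g01 (restrict_coords A x)).
- apply: ge_sup => // _ [x _ <-].
  by rewrite -(restrict_coords_sub _ AB); exact: support_measure_ge.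
- apply: ge_sup => // _ [x _ <-]; rewrite restrict_coordsU//.
  by apply: (le_trans (gM _ _)); apply: lerD; exact: support_measure_ge.
- have inv0 n : 0 < n.+1%:R^-1 :> R by rewrite invr_gt0.
  have /choice[u uP] n : exists x : PG,
      support_measure (A n) - n.+1%:R^-1 < g (restrict_coords (A n) x).
    have [_ [x _ <-] xP] := sup_adherent (inv0 n) (conj (ne (A n)) (hub (A n))).
    by exists x.
  apply: (@squeeze_cvgr _ _ _ _ (fun=> 0)
      (fun n => g (restrict_coords (A n) (u n)) + n.+1%:R^-1)).
  + by near=> n; rewrite support_measure_ge0 /= -lerBlDr ltW.
  + exact: cvg_cst.
  + rewrite -(addr0 (0 : R)); apply: cvgD; last exact: cvg_harmonic.
    by apply: g_seq; exact: cvg_restrict_coords.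
Unshelve. all: by end_near. Qed.

(** A point supported in a finite set is a finite product of one-coordinate points,
so subadditivity reduces the limit to those. *)
Lemma cvg_restrict_finite (Phi : set_system PG) {FF : Filter Phi} (F : set I) :
  g 1%g = 0 -> (forall i, g (inj_coord (x i)) @[x --> Phi] --> (0 : R)) ->
  finite_set F -> g (restrict_coords F x) @[x --> Phi] --> (0 : R).
Proof.
move=> g1 g_coord finF.
have [s] : exists s : seq {classic I}, F = [set` s] by exact/finite_seqP.
(* Removing an index from F keeps it inside the list, so the induction is on an
   inclusion rather than on the equality with the list. *)
move=> /seteqP[+ _]; elim: s F {finF} => [|a s IH] F Fs.
  have -> : F = set0 by apply/seteqP; split=> // b /Fs.
  have -> : (fun x => g (restrict_coords set0 x)) = fun=> 0.
    by apply/funext => x; rewrite restrict_coords0.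
  exact: cvg_cst.
have FD : g (restrict_coords (F `\ a) x) @[x --> Phi] --> (0 : R).
  by apply: IH => b [/Fs /=]; rewrite inE => /orP[/eqP ->|].
have [Fa|nFa] := pselect (F a); last first.
  suff <- : F `\ a = F by [].
  by apply/seteqP; split=> [b []//|b Fb]; split=> // /= ba; rewrite -ba in nFa.
apply: (@squeeze_cvgr _ _ _ _ (fun=> 0)
  (fun x : PG => g (inj_coord (x a)) + g (restrict_coords (F `\ a) x))).
- near=> x; case/andP: (g01 (restrict_coords F x)) => -> _ /=.
  rewrite -restrict_coords1 -{1}(setD1K Fa) restrict_coordsU//.
  by apply/seteqP; split=> // b [/= -> []].
- exact: cvg_cst.
- by rewrite -(addr0 (0 : R)); exact: cvgD.
Unshelve. all: by end_near. Qed.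

End SupportMeasure.

End ProductSupport.

(** * Continuity of homomorphisms *)

Lemma multiplicative1 (G H : groupType) (f : {multiplicative G -> H}) :
  f 1%g = 1%g.
Proof. by apply: (@mulgI _ (f 1%g)); rewrite -gmulfM !mulg1. Qed.

Lemma continuous_at1 (G H : topologicalGroupType) (f : {multiplicative G -> H}) :
  {for 1%g, continuous f} -> continuous f.
Proof.
move=> f1 x.
pose h y := (f x * f (x^-1 * y))%g.
have fE : f = h :> (G -> H) by apply/funext => y; rewrite /h -gmulfM mulVKg.
rewrite fE {fE}.
have mulx (K : topologicalGroupType) (k y : K) : (k * z)%g @[z --> y] --> (k * y)%g.
  apply: (@continuous_comp _ _ _ (fun z : K => (k, z)) (fun z => z.1 * z.2)%g);
    last exact: mulg_continuous.
  by apply: cvg_pair; [exact: cvg_cst|exact: cvg_id].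
apply: (@continuous_comp _ _ _ (fun y => f (x^-1 * y)%g) (fun z => f x * z)%g);
  last exact: mulx.
apply: (@continuous_comp _ _ _ (fun y => x^-1 * y)%g f); first exact: mulx.
by rewrite mulVg.
Qed.

Theorem theorem3p2 (R : realType) (A : Type) (G : A -> topologicalGroupType)
    (hG : forall a : A, g_sequential (G a))
    (hA : ~ card_g_sequential R A) :
  g_sequential (prod_topology G).
Proof.
move=> H f fseq; apply: continuous_at1.
have f_coord a : f (inj_coord x) @[x --> (1%g : G a)] --> (1%g : H).
  have -> : (1%g : H) = (f \o @inj_coord A G a) 1%g by rewrite multiplicative1.
  apply: (hG a H (f \o @inj_coord A G a)) => u x ux; apply: fseq.
  exact: (cvg_comp _ _ ux (@inj_coord_continuous A G a x)).
rewrite /prop_for /= /continuous_at multiplicative1.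
move=> U /(exists_prenorm R)[N [N01 NM Ncvg NU]].
pose g (x : prod_topology G) := N (f x).
have g01 x : 0 <= g x <= 1 := N01 _.
have gM x y : g (x * y)%g <= g x + g y by rewrite /g gmulfM.
have gseq (u : nat -> prod_topology G) :
    u n @[n --> \oo] --> (1%g : prod_topology G) ->
    g (u n) @[n --> \oo] --> (0 : R).
  by move=> /fseq; rewrite multiplicative1 => fu; exact: (cvg_comp _ _ fu Ncvg).
have g1 : g 1%g = 0.
  have /(cvg_lim (@Rhausdorff R)) : g ((fun=> 1%g) n) @[n --> \oo] --> (0 : R).
    by apply: gseq; exact: cvg_cst.
  by rewrite lim_cst.
have pmeas := support_measure_subadditive g01 gM gseq.
(* The two factors of x are allotted 1/4 each, N < 1/2 being what U needs. *)
have e4 : (0 : R) < 4^-1 by rewrite invr_gt0.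
have [F finF pF] := submeas_finite_approx pmeas hA e4.
have g_coord a :
    g (inj_coord (x a)) @[x --> (1%g : prod_topology G)] --> (0 : R).
  have xa : x a @[x --> (1%g : prod_topology G)] --> (1%g : G a).
    exact: (@prod_topology_proj_continuous A G a 1%g).
  exact: (cvg_comp _ _ (cvg_comp _ _ xa (f_coord a)) Ncvg).
have F1 : Filter (nbhs (1%g : prod_topology G)) := nbhs_filter _.
have /(@cvgr0Pnorm_lt _ _ _ _ F1)/(_ _ e4) :=
  cvg_restrict_finite (FF := F1) g01 gM g1 g_coord finF.
apply: filterS => x xF; apply: NU.
have := gM (restrict_coords F x) (restrict_coords (~` F) x).
rewrite -restrict_coordsU ?setICr// setUv restrict_coordsT.
have := support_measure_ge g01 (~` F) x.
have := ler_norm (g (restrict_coords F x)).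
rewrite /g in xF pF *; lra.
Qed.
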